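(* Let $P\subset\mathbb{Z}^n$ be a polymatroid with ground set $[n]$ and rank function $f$. Then the coefficient of the term of degree $n-1$ in $\mathcal{J}_P(x,1)$ is $$\sum_{i\in[n]}f(\{i\})-f([n]),$$ and the coefficient of the term of degree $n-1$ in $\mathcal{J}_P(1,y)$ is $$\sum_{i\in[n]}f([n]\setminus\{i\})-(n-1)f([n]).$$
   Context: Let $n$ be a positive integer, $[n]=\{1,\dots,n\}$, and let $\mathbf{e}_1,\dots,\mathbf{e}_n$ be the canonical basis of $\mathbb{R}^n$. A (integer) polymatroid $P$ with ground set $[n]$ is given by its rank function $f:2^{[n]}\to\mathbb{Z}$, which satisfies $f(\emptyset)=0$ and submodularity: $f(I)+f(J)\ge f(I\cup J)+f(I\cap J)$ for all $I,J\subseteq[n]$. Its set of bases is $$PB=\Big\{\mathbf{a}\in\mathbb{Z}^n : \sum_{i\in I}a_i\le f(I)\text{ for all } I\subseteq[n],\ \sum_{i\in[n]}a_i=f([n])\Big\}.$$ For $\mathbf{a}\in PB$, an index $i\in[n]$ is internally active if $\mathbf{a}-\mathbf{e}_i+\mathbf{e}_j\notin PB$ for every $j<i$, and externally active if $\mathbf{a}+\mathbf{e}_i-\mathbf{e}_j\notin PB$ for every $j<i$. Let $Int(\mathbf{a})$ and $Ext(\mathbf{a})$ denote the sets of internally and externally active indices with respect to $\mathbf{a}$. The polymatroid Tutte polynomial is $$\mathcal{J}_P(x,y)=\sum_{\mathbf{a}\in PB}x^{oi(\mathbf{a})}y^{oe(\mathbf{a})}(x+y-1)^{ie(\mathbf{a})},$$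 where $oi(\mathbf{a})=|Int(\mathbf{a})\setminus Ext(\mathbf{a})|$, $oe(\mathbf{a})=|Ext(\mathbf{a})\setminus Int(\mathbf{a})|$, $ie(\mathbf{a})=|Int(\mathbf{a})\cap Ext(\mathbf{a})|$. *)

(* Defs.v *)
From HB Require Import structures.
From mathcomp Require Import all_boot all_order all_algebra.
From mathcomp Require Import boolp classical_sets cardinality fsbigop.
From mathcomp Require Import polyXY lra zify.

Set Implicit Arguments.
Unset Strict Implicit.
Unset Printing Implicit Defensive.

Import Order.TTheory GRing.Theory Num.Theory.
Local Open Scope ring_scope.

(* The ground set [n] is 'I_n with its usual order (so indices start at 0).
   The rank function need be neither monotone nor nonnegative. *)
Record polymatroid (n : nat) := Polymatroid {
  rank :> {set 'I_n} -> int;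
  rank0 : rank finset.set0 = 0;
  rank_submodular : forall I J : {set 'I_n},
    rank (I :|: J) + rank (I :&: J) <= rank I + rank J }.

Definition bases (n : nat) (P : polymatroid n) : {pred 'rV[int]_n} :=
  fun a => [forall I : {set 'I_n}, \sum_(i in I) a 0 i <= P I]
           && (\sum_i a 0 i == P [set: 'I_n]%SET).

Definition basis_vector (n : nat) (i : 'I_n) : 'rV[int]_n := delta_mx 0 i.

Definition Int_active (n : nat) (P : polymatroid n) (a : 'rV[int]_n) :
    {set 'I_n} :=
  [set i : 'I_n | [forall (j : 'I_n | (j < i)%N),
     a - basis_vector i + basis_vector j \notin bases P]]%SET.

Definition Ext_active (n : nat) (P : polymatroid n) (a : 'rV[int]_n) :
    {set 'I_n} :=
  [set i : 'I_n | [forall (j : 'I_n | (j < i)%N),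
     a + basis_vector i - basis_vector j \notin bases P]]%SET.

Definition oi (n : nat) (P : polymatroid n) (a : 'rV[int]_n) : nat :=
  #|Int_active P a :\: Ext_active P a|.

Definition oe (n : nat) (P : polymatroid n) (a : 'rV[int]_n) : nat :=
  #|Ext_active P a :\: Int_active P a|.

Definition ie (n : nat) (P : polymatroid n) (a : 'rV[int]_n) : nat :=
  #|Int_active P a :&: Ext_active P a|.

(* The library's sum over a classical set is 0 when infinitely many terms are
   nonzero; by [bases_finite] below this never happens here. *)
Definition polymatroid_tutte (n : nat) (P : polymatroid n) :
    {poly {poly int}} :=
  \sum_(a \in [set` bases P])
     ('X ^+ oi P a * 'Y ^+ oe P a * ('X + 'Y - 1) ^+ ie P a
        : {poly {poly int}}).

(* With 'Y = 'X%:P, the outer variable is x and the inner one is y: setting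
   y = 1 evaluates each coefficient, setting x = 1 evaluates the outer
   polynomial. *)
Definition subst_y1 (J : {poly {poly int}}) : {poly int} :=
  map_poly (horner_eval 1) J.

Definition subst_x1 (J : {poly {poly int}}) : {poly int} := J.[1].

Lemma subst_y1XY (J : {poly {poly int}}) (x : int) :
  (subst_y1 J).[x] = J.[x, 1].
Proof.
by rewrite /subst_y1 -[x in LHS](hornerC x 1) (horner_map (horner_eval 1)).
Qed.

Lemma subst_x1XY (J : {poly {poly int}}) (y : int) :
  (subst_x1 J).[y] = J.[1, y].
Proof. by []. Qed.

Lemma bases_finite (n : nat) (P : polymatroid n) : finite_set [set` bases P].
Proof.
have bound (x p q r : int) (b : nat) : x <= r -> q - x <= p ->
    `|q|%:Z + `|p|%:Z <= b%:Z -> `|r|%:Z <= b%:Z -> - b%:Z <= x <= b%:Z.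
  by lia.
have shift_lt (x : int) (b : nat) : - b%:Z <= x <= b%:Z ->
    (`|(x + b%:Z)%R| < b.*2.+1)%N by lia.
have shiftK (x : int) (b : nat) : - b%:Z <= x <= b%:Z ->
    x = `|(x + b%:Z)%R|%N%:Z - b%:Z by lia.
pose B := (\sum_(I : {set 'I_n}) `|P I|)%N.
have leB1 (I : {set 'I_n}) : `|P I|%:Z <= B%:Z.
  by rewrite /B (bigD1 I) //=; lia.
have leB2 (I J : {set 'I_n}) : I != J -> `|P I|%:Z + `|P J|%:Z <= B%:Z.
  by move=> IJ; rewrite /B (bigD1 I) //= (bigD1 J) 1?eq_sym //=; lia.
pose g (h : {ffun 'I_n -> 'I_(B.*2).+1}) : 'rV[int]_n :=
  \row_i ((h i)%:Z - B%:Z).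
apply: (@sub_finite_set _ _ [set` map g (enum {ffun 'I_n -> 'I_(B.*2).+1})]);
  last exact: finite_seq.
move=> /= a /andP[/forallP le_a /eqP sum_a].
have bnd (i : 'I_n) : - B%:Z <= a 0 i <= B%:Z.
  have a_le := le_a [set i]%SET; rewrite big_set1 in a_le.
  have a_ge := le_a (~: [set i])%SET.
  have eqc : \sum_(j in ~: [set i]%SET) a 0 j = P [set: 'I_n]%SET - a 0 i.
    rewrite -sum_a [in RHS](bigD1 i) //= addrAC subrr add0r.
    by apply: eq_bigl => j; rewrite !inE.
  rewrite eqc in a_ge.
  apply: bound a_le a_ge (leB2 _ _ _) (leB1 _).
  by apply/eqP => /setP /(_ i); rewrite !inE eqxx.
apply/mapP; exists [ffun i => inord `|(a 0 i + B%:Z)%R|%N]; first by rewrite mem_enum.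
by apply/rowP => i; rewrite mxE ffunE inordK; [exact: shiftK | exact: shift_lt].
Qed.

(* Main.v *)
Require Import Defs.
From mathcomp Require Import finmap classical_sets cardinality fsbigop.
From mathcomp Require Import all_boot all_order all_algebra.
From mathcomp Require Import polyXY zify.

(** Setting [y = 1] turns the weight of a base [a] into [x ^ #|Int a|], so the
    coefficient of degree [n - 1] counts the bases with exactly one internally
    inactive index.  Fix that index [i] and write [f] for the rank function,
    [[<i]] and [[<=i]] for the initial segments of the ground set.  The bases
    whose only inactive index is [i] are in bijection, through their [i]-th
    coordinate [t], with the integers
    [f [<=i] - f [<i] < t <= f {i}].

    To see this, call a set [I] tight for [a] if [a] sums to [f I] on it.  Tight
    sets are closed under union and intersection, and an exchange
    [a - e_i + e_j] leaves the polytope exactly when some tight set contains [j]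
    and not [i].  Hence [i] is internally active iff some tight set contains
    [[<i]] and avoids [i] ([Int_activeP]).  If all indices but [i] are active,
    intersecting these witnesses from the top downwards yields, for each [k],
    a tight set equal to [[<k]] up to the element [i] ([sandwiched_tight]).
    This says that [a] is tight on [{i} U [<k]], for every [k], with respect to
    the truncated rank [min (f I, f (I - i) + t)] on sets [I] containing [i],
    the rank function of the bases with [i]-th coordinate at most [t].  So [a]
    is the greedy base of the truncation for the order in which [i] comes first
    ([cofacet_greedy]), and is determined by [t]; conversely the greedy base has
    the required activities whenever [t] is in the interval ([greedy_basis],
    [Int_greedy]).

    The interval has [f {i} - (f [<=i] - f [<i])] elements; summing over [i],
    the bracket telescopes to [f [n]].  For [x = 1], negation carries the bases
    of [f] to those of the dual rank [I |-> f (~ I) - f [n]] and exchanges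
    external with internal activity, so the second formula is the first one
    applied to the dual. *)

Set Implicit Arguments.
Unset Strict Implicit.
Unset Printing Implicit Defensive.

Import Order.TTheory GRing.Theory Num.Theory.
Local Open Scope ring_scope.

(** * Tight sets and activity *)

Definition weight (n : nat) (a : 'rV[int]_n) (I : {set 'I_n}) : int :=
  \sum_(i in I) a 0 i.

Definition tight (n : nat) (P : polymatroid n) (a : 'rV[int]_n)
    (I : {set 'I_n}) : bool :=
  weight a I == P I.

Definition initial (n k : nat) : {set 'I_n} := [set j : 'I_n | (j < k)%N]%SET.

Lemma weightUI (n : nat) (a : 'rV[int]_n) (I J : {set 'I_n}) :
  weight a (I :|: J) + weight a (I :&: J) = weight a I + weight a J.
Proof.
have mk (K : {set 'I_n}) : weight a K = \sum_i if i \in K then a 0 i else 0.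
  exact: big_mkcond.
rewrite !mk -!big_split; apply: eq_bigr => i _ /=.
by rewrite !inE; case: (i \in I); case: (i \in J); rewrite //= addrC.
Qed.

Lemma weight0 (n : nat) (a : 'rV[int]_n) : weight a set0 = 0.
Proof. by rewrite /weight big_set0. Qed.

Lemma weight1 (n : nat) (a : 'rV[int]_n) (i : 'I_n) :
  weight a [set i]%SET = a 0 i.
Proof. by rewrite /weight big_set1. Qed.

Lemma weightU1 (n : nat) (a : 'rV[int]_n) (i : 'I_n) (I : {set 'I_n}) :
  i \notin I -> weight a (i |: I)%SET = a 0 i + weight a I.
Proof. by move=> iNI; rewrite /weight big_setU1. Qed.

Lemma weightD1 (n : nat) (a : 'rV[int]_n) (i : 'I_n) (I : {set 'I_n}) :
  weight a I = weight a (I :\ i)%SET + (i \in I)%:R * a 0 i.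
Proof.
case: (boolP (i \in I)) => iI; last first.
  by rewrite mul0r addr0 (setDidPl _) // disjoint_sym disjoints1.
by rewrite -{1}(setD1K iI) weightU1 ?inE ?eqxx // mul1r addrC.
Qed.

Lemma weight_exchange (n : nat) (a : 'rV[int]_n) (i j : 'I_n)
    (I : {set 'I_n}) :
  weight (a - basis_vector i + basis_vector j) I
    = weight a I - (i \in I)%:R + (j \in I)%:R.
Proof.
have wt_delta (k : 'I_n) : \sum_(l in I) basis_vector k 0 l = (k \in I)%:R.
  rewrite big_mkcond (bigD1 k) //= !mxE !eqxx big1 ?addr0; first by case: ifP.
  by move=> l lk; rewrite !mxE (negPf lk) andbF; case: ifP.
rewrite -!wt_delta /weight -sumrB -big_split /=.
by apply: eq_bigr => l _; rewrite !mxE.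
Qed.

Lemma in_bases (n : nat) (P : polymatroid n) (a : 'rV[int]_n) :
  (a \in bases P)
    = [forall I, weight a I <= P I] && tight P a [set: 'I_n]%SET.
Proof.
by rewrite /tight /weight unfold_in (eq_bigl (mem [set: 'I_n]%SET)) // => i;
  rewrite !inE.
Qed.

Lemma weight_le (n : nat) (P : polymatroid n) (a : 'rV[int]_n)
    (I : {set 'I_n}) :
  a \in bases P -> weight a I <= P I.
Proof. by rewrite in_bases => /andP[/forallP]. Qed.

Lemma tight0 (n : nat) (P : polymatroid n) (a : 'rV[int]_n) :
  tight P a set0.
Proof. by rewrite /tight weight0 rank0. Qed.

(** Submodularity is squeezed between [weight_le] for the union and the
    intersection and the modularity of [weight]. *)
Lemma tightUI (n : nat) (P : polymatroid n) (a : 'rV[int]_n)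
    (I J : {set 'I_n}) :
  a \in bases P -> tight P a I -> tight P a J ->
  tight P a (I :|: J)%SET && tight P a (I :&: J)%SET.
Proof.
move=> aB; rewrite /tight => /eqP tI /eqP tJ.
have := weightUI a I J; have := rank_submodular P I J.
have := weight_le (I :|: J)%SET aB; have := weight_le (I :&: J)%SET aB.
by lia.
Qed.

(** The exchange raises by one the weight of the sets containing [j] and not
    [i] and of no others, so only tight sets of this kind obstruct it. *)
Lemma exchangeP (n : nat) (P : polymatroid n) (a : 'rV[int]_n) (i j : 'I_n) :
  a \in bases P ->
  (a - basis_vector i + basis_vector j \in bases P)
    = [forall I, tight P a I ==> (j \in I) ==> (i \in I)].
Proof.
move=> aB; rewrite in_bases.
have -> : tight P (a - basis_vector i + basis_vector j) [set: 'I_n]%SET.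
  rewrite /tight weight_exchange !inE subrK.
  by move: aB; rewrite in_bases => /andP[].
rewrite andbT; apply: eq_forallb => I.
rewrite weight_exchange /tight; have := weight_le I aB.
by case: (i \in I); case: (j \in I) => /=; lia.
Qed.

(** Every [j < i] has its own tight obstruction to the exchange; their union
    is a single tight set that obstructs all of them. *)
Lemma Int_activeP (n : nat) (P : polymatroid n) (a : 'rV[int]_n) (i : 'I_n) :
  a \in bases P ->
  reflect (exists I : {set 'I_n},
             [/\ tight P a I, initial n i \subset I & i \notin I])
          (i \in Int_active P a).
Proof.
move=> aB; apply: (iffP idP) => [|[I [tI sI iI]]]; last first.
  rewrite inE; apply/forallP => j; apply/implyP => ji.
  rewrite exchangeP // negb_forall; apply/existsP; exists I.
  by rewrite tI (negPf iI) (subsetP sI) // inE.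
rewrite inE => /forallP act.
suff ex k : (k <= i)%N -> exists I : {set 'I_n},
    [/\ tight P a I, initial n k \subset I & i \notin I] by exact: ex.
elim: k => [_|k IHk ki].
  by exists set0; rewrite tight0 inE; split=> //; apply/subsetP => j; rewrite inE.
have [I [tI sI iI]] := IHk (ltnW ki).
pose k' := Ordinal (ltn_trans ki (ltn_ord i)).
have := act k'; rewrite ki exchangeP //= negb_forall => /existsP[J].
rewrite !negb_imply => /and3P[tJ kJ iJ].
exists (I :|: J)%SET; split; first by case/andP: (tightUI aB tI tJ).
  apply/subsetP => j; rewrite !inE ltnS leq_eqVlt => /orP[jk|jk].
    by rewrite (_ : j = k') ?kJ ?orbT //; exact/eqP.
  by rewrite (subsetP sI) // inE.
by rewrite inE negb_or iI.
Qed.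

(** * Truncating one coordinate *)

(** The rank function of the polymatroid cut by the half-space [a_i <= t].
    Since [t] may be negative, the minimum must not be taken on sets that
    avoid [i]: there the two terms agree, thanks to the factor [(i \in I)]. *)
Definition truncated_rank (n : nat) (P : polymatroid n) (i : 'I_n) (t : int)
    (I : {set 'I_n}) : int :=
  Num.min (P I) (P (I :\ i)%SET + (i \in I)%:R * t).

Lemma truncated_rank0 (n : nat) (P : polymatroid n) (i : 'I_n) (t : int) :
  truncated_rank P i t set0 = 0.
Proof.
rewrite /truncated_rank set0D !rank0 inE.
by lia.
Qed.

(** Each side of the minimum evaluates [P] at [I] or [I :\ i]; submodularity
    of [P] at the four combinations of these choices for [I] and [J] bounds
    the minima at the union and the intersection. *)
Lemma truncated_rank_submodular (n : nat) (P : polymatroid n) (i : 'I_n)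
    (t : int) (I J : {set 'I_n}) :
  truncated_rank P i t (I :|: J) + truncated_rank P i t (I :&: J)
    <= truncated_rank P i t I + truncated_rank P i t J.
Proof.
rewrite /truncated_rank.
have s1 := rank_submodular P I J.
have s2 := rank_submodular P (I :\ i)%SET J.
have s3 := rank_submodular P I (J :\ i)%SET.
have s4 := rank_submodular P (I :\ i)%SET (J :\ i)%SET.
have e1 : ((I :\ i) :|: (J :\ i) = (I :|: J) :\ i)%SET by rewrite setDUl.
have e2 : ((I :\ i) :&: (J :\ i) = (I :&: J) :\ i)%SET by rewrite setDIl.
have e3 : ((I :\ i) :&: J = (I :&: J) :\ i)%SET.
  by apply/setP => k; rewrite !inE andbA.
have e4 : (I :&: (J :\ i) = (I :&: J) :\ i)%SET.
  by apply/setP => k; rewrite !inE andbCA.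
have e5 : ((I :\ i) :|: J = if i \in J then I :|: J else (I :|: J) :\ i)%SET.
  case: ifP => iJ; apply/setP => k; rewrite !inE; case: eqP => //= ->;
  by rewrite iJ ?orbT.
have e6 : (I :|: (J :\ i) = if i \in I then I :|: J else (I :|: J) :\ i)%SET.
  case: ifP => iI; apply/setP => k; rewrite !inE; case: eqP => //= ->;
  by rewrite iI ?orbT.
rewrite e1 e2 in s4; rewrite e3 e5 in s2; rewrite e4 e6 in s3.
rewrite !inE.
by case: (i \in I) s2 s3; case: (i \in J) => /= s2 s3; lia.
Qed.

Definition truncation (n : nat) (P : polymatroid n) (i : 'I_n) (t : int) :
    polymatroid n :=
  Polymatroid (truncated_rank0 P i t) (truncated_rank_submodular P i t).

(** * Greedy bases *)

(** The step in the proof that the greedy algorithm is correct: a vector that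
    is tight along a flag obeys all the rank inequalities.  If [I] is not
    inside [Q], then [I :|: Q] is the next member of the flag, and
    submodularity at [I] and [Q] transfers the inequality from [I :&: Q]. *)
Lemma tight_flag_step (n : nat) (P : polymatroid n) (a : 'rV[int]_n)
    (k : 'I_n) (Q : {set 'I_n}) :
  tight P a Q -> tight P a (k |: Q)%SET ->
  (forall I : {set 'I_n}, I \subset Q -> weight a I <= P I) ->
  forall I : {set 'I_n}, I \subset (k |: Q)%SET -> weight a I <= P I.
Proof.
rewrite /tight => /eqP tQ /eqP tkQ leQ I sI.
have [IQ|nIQ] := boolP (I \subset Q); first exact: leQ.
have kI : k \in I.
  apply: contraR nIQ => kI; apply/subsetP => j jI.
  by case/setU1P: (subsetP sI j jI) => // jk; rewrite -jk jI in kI.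
have eU : (I :|: Q = k |: Q)%SET.
  apply/eqP; rewrite eqEsubset subUset sI subsetUr.
  by rewrite setSU ?sub1set.
have := weightUI a I Q; have := rank_submodular P I Q.
have := leQ (I :&: Q)%SET (subsetIr _ _).
by rewrite eU; lia.
Qed.

Lemma initial_full (n : nat) : initial n n = [set: 'I_n]%SET.
Proof. by apply/setP => j; rewrite !inE ltn_ord. Qed.

Lemma initial0 (n : nat) : initial n 0 = set0.
Proof. by apply/setP => j; rewrite !inE. Qed.

Lemma initialS (n : nat) (k : 'I_n) : initial n k.+1 = (k |: initial n k)%SET.
Proof. by apply/setP => j; rewrite !inE ltnS leq_eqVlt. Qed.

(** The greedy base of the truncation for the order that puts [i] first and
    keeps the others in their natural order. *)
Definition greedy (n : nat) (P : polymatroid n) (i : 'I_n) (t : int) :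
    'rV[int]_n :=
  \row_k if k == i then t
         else truncation P i t (i |: initial n k.+1)%SET
              - truncation P i t (i |: initial n k)%SET.

Lemma flag_greedy (n : nat) (P : polymatroid n) (i : 'I_n) (t : int)
    (a : 'rV[int]_n) :
  a 0 i = t ->
  (forall k, (k <= n)%N -> tight (truncation P i t) a (i |: initial n k)%SET) ->
  a = greedy P i t.
Proof.
move=> ai ta; apply/rowP => k; rewrite mxE; case: eqP => [->//|/eqP ki].
rewrite -(eqP (ta k (ltnW (ltn_ord k)))) -(eqP (ta k.+1 (ltn_ord k))).
rewrite initialS setUCA weightU1 ?addrK //.
by rewrite !inE negb_or ki ltnn.
Qed.

Lemma greedy_tight (n : nat) (P : polymatroid n) (i : 'I_n) (t : int)
    (k : nat) :
  t <= P [set i]%SET -> (k <= n)%N ->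
  tight (truncation P i t) (greedy P i t) (i |: initial n k)%SET.
Proof.
move=> tle; rewrite /tight; elim: k => [_|k IHk kn].
  rewrite initial0 setU0 weight1 mxE eqxx /= /truncated_rank.
  by rewrite setDv rank0 inE eqxx; lia.
pose k' := Ordinal kn; rewrite -[k]/(nat_of_ord k').
have [ki|ki] := eqVneq k' i.
  rewrite initialS ki setUA setUid.
  by have := IHk (ltnW kn); rewrite -[k]/(nat_of_ord k') ki.
rewrite {1}initialS setUCA weightU1 ?inE ?negb_or ?ki ?ltnn //.
by rewrite (eqP (IHk (ltnW kn))) mxE (negPf ki) subrK.
Qed.

(** Beyond [i] the truncation is invisible: by submodularity the marginal of
    [i] over [initial n k :\ i] is at most its marginal over [initial n i],
    hence less than [t]. *)
Lemma truncation_late (n : nat) (P : polymatroid n) (i : 'I_n) (t : int)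
    (k : nat) :
  P (initial n i.+1) - P (initial n i) < t -> (i < k)%N ->
  truncation P i t (initial n k) = P (initial n k).
Proof.
move=> tlo ik; rewrite /= /truncated_rank inE ik mul1r.
have := rank_submodular P (initial n k :\ i)%SET (initial n i.+1).
rewrite (_ : (_ :|: _) = initial n k); last first.
  by apply/setP => j; rewrite !inE -val_eqE /=; lia.
rewrite (_ : (_ :&: _) = initial n i); last first.
  by apply/setP => j; rewrite !inE -val_eqE /=; lia.
by lia.
Qed.

Lemma initial_late (n k : nat) (i : 'I_n) :
  (i < k)%N -> (i |: initial n k)%SET = initial n k.
Proof. by move=> ik; apply/setUidPr; rewrite sub1set inE. Qed.

Lemma greedy_tight_late (n : nat) (P : polymatroid n) (i : 'I_n) (t : int)
    (k : nat) :
  P (initial n i.+1) - P (initial n i) < t <= P [set i]%SET ->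
  (i < k <= n)%N -> tight P (greedy P i t) (initial n k).
Proof.
move=> /andP[tlo tle] /andP[ik kn].
have := greedy_tight tle kn; rewrite initial_late // /tight => /eqP ->.
by rewrite truncation_late.
Qed.

(** Walking along the flag [{i} U initial n k] gives feasibility for the
    truncated rank, which lies below [P] and agrees with it on the full set. *)
Lemma greedy_basis (n : nat) (P : polymatroid n) (i : 'I_n) (t : int) :
  P (initial n i.+1) - P (initial n i) < t <= P [set i]%SET ->
  greedy P i t \in bases P.
Proof.
move=> tb; have /andP[tlo tle] := tb.
set a := greedy P i t.
have flag k : (k <= n)%N -> forall I : {set 'I_n},
    I \subset (i |: initial n k)%SET -> weight a I <= truncation P i t I.
  elim: k => [_|k IHk kn] I.
    rewrite initial0.
    apply: tight_flag_step; rewrite ?tight0 //.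
      by rewrite -initial0; exact: greedy_tight.
    by move=> J; rewrite subset0 => /eqP ->; rewrite weight0 rank0.
  pose k' := Ordinal kn; rewrite -[k]/(nat_of_ord k') initialS setUCA.
  apply: tight_flag_step; first exact: greedy_tight (ltnW kn).
    by rewrite setUCA -initialS; exact: greedy_tight.
  exact: IHk (ltnW kn).
have tT : tight P a [set: 'I_n]%SET.
  by rewrite -initial_full; apply: greedy_tight_late; rewrite ?ltn_ord ?leqnn.
rewrite in_bases tT andbT.
apply/forallP => I.
apply: (@le_trans _ _ (truncation P i t I)); last by rewrite /= /truncated_rank; lia.
by apply: (flag n) => //; rewrite initial_full setUT subsetT.
Qed.

Lemma truncation_tight (n : nat) (P : polymatroid n) (a : 'rV[int]_n)
    (i : 'I_n) (I : {set 'I_n}) :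
  a \in bases P ->
  tight (truncation P i (a 0 i)) a I = tight P a I || tight P a (I :\ i)%SET.
Proof.
move=> aB; rewrite /tight /= /truncated_rank.
have := weight_le I aB; have := weight_le (I :\ i)%SET aB.
have := weightD1 a i I.
by move: (_%:R * a 0 i) => x; lia.
Qed.

(** Tightness along the flag for the truncated rank means tightness for [P]
    with or without [i] added, and for [k < i] either set witnesses the
    activity of [k]; for [k > i] the truncation is invisible and
    [initial n k] itself is a witness.  A witness for [i] itself would cut
    [initial n i.+1] down to a tight [initial n i] and so force [t] to its
    excluded lower bound. *)
Lemma Int_greedy (n : nat) (P : polymatroid n) (i : 'I_n) (t : int) :
  P (initial n i.+1) - P (initial n i) < t <= P [set i]%SET ->
  Int_active P (greedy P i t) = (~: [set i])%SET.
Proof.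
move=> tb; have /andP[tlo tle] := tb.
have aB := greedy_basis tb; set a := greedy P i t in aB *.
have ai : a 0 i = t by rewrite mxE eqxx.
apply/setP => k; rewrite in_setC in_set1; apply/Int_activeP/idP => //.
  case=> I [tI sI kI]; apply/eqP => ki; rewrite ki in sI kI.
  have tS : tight P a (initial n i.+1).
    by apply: greedy_tight_late; rewrite ?ltnSn ?ltn_ord.
  have [_] := andP (tightUI aB tI tS).
  (* [I] contains [initial n i] but not [i], so intersecting with
     [initial n i.+1] leaves exactly [initial n i]. *)
  rewrite (_ : (_ :&: _)%SET = initial n i); last first.
    rewrite initialS; apply/setP => j; rewrite !inE.
    have := subsetP sI j; rewrite inE.
    case: eqP => [-> _|_ sj]; first by rewrite (negPf kI) ltnn.
    by case: (ltnP j i) sj => [_ ->|]; rewrite // andbF.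
  move=> tp; move: tS tp; rewrite /tight initialS weightU1 ?inE ?ltnn //.
  by rewrite ai -initialS; lia.
move=> ki; have kn := ltnW (ltn_ord k).
have [ik|] := ltnP i k.
  exists (initial n k); rewrite inE ltnn; split=> //.
  by apply: greedy_tight_late; rewrite ?ik.
rewrite leq_eqVlt val_eqE (negPf ki) /= => lki.
have := greedy_tight tle kn; rewrite -/a -ai truncation_tight //.
case/orP => tk; eexists; (split; first exact: tk).
- exact: subsetUr.
- by rewrite !inE negb_or ki ltnn.
- apply/subsetP => j; rewrite !inE => jk; rewrite jk orbT andbT.
  by rewrite -val_eqE /=; lia.
- by rewrite !inE ltnn orbF andNb.
Qed.

(** * Bases with a single inactive index *)

(** Induction downwards from the full set: the witness of the activity of [m]
    removes [m] from the tight set and keeps the smaller indices.  Nothing has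
    to be removed at [m = i], which is why the membership of [i] is left
    undetermined. *)
Lemma sandwiched_tight (n : nat) (P : polymatroid n) (a : 'rV[int]_n)
    (i : 'I_n) (k : nat) :
  a \in bases P -> Int_active P a = (~: [set i])%SET -> (k <= n)%N ->
  exists K : {set 'I_n}, [/\ tight P a K, (initial n k :\ i)%SET \subset K
    & K \subset (i |: initial n k)%SET].
Proof.
move=> aB act kn; rewrite -(subKn kn).
elim: (n - k)%N (leq_subr k n) => [_|d IHd dn].
  exists [set: 'I_n]%SET; split; rewrite ?subsetT //.
    by move: aB; rewrite in_bases => /andP[].
  by rewrite subn0 initial_full setUT.
have [K [tK sK Ks]] := IHd (ltnW dn).
have mn : (n - d.+1 < n)%N by lia.
pose m := Ordinal mn; rewrite -[(n - _)%N]/(nat_of_ord m).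
have eS : initial n (n - d) = (m |: initial n m)%SET.
  by rewrite -initialS /=; congr initial; lia.
rewrite eS in sK Ks.
have [mi|mi] := eqVneq m i.
  exists K; rewrite mi in sK Ks *; split=> //; last first.
    by rewrite setUA setUid in Ks.
  by apply: subset_trans sK; apply: setSD; exact: subsetUr.
have /(Int_activeP _ aB)[I [tI sI mI]] : m \in Int_active P a.
  by rewrite act !inE.
exists (K :&: I)%SET; split; first by case/andP: (tightUI aB tK tI).
  apply/subsetP => j; rewrite !inE => /andP[ji jm]; apply/andP; split.
    by apply: (subsetP sK); rewrite !inE ji jm orbT.
  by apply: (subsetP sI); rewrite inE.
apply/subsetP => j; rewrite inE => /andP[jK jI].
have := subsetP Ks j jK; rewrite !inE => /or3P[->//|jm|->]; last by rewrite orbT.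
by rewrite (eqP jm) (negPf mI) in jI.
Qed.

(** The tight set of [sandwiched_tight] is the flag member [{i} U initial n k]
    either itself or without [i]; these are the two ways for the flag member
    to be tight for the truncated rank. *)
Lemma cofacet_greedy (n : nat) (P : polymatroid n) (a : 'rV[int]_n)
    (i : 'I_n) :
  a \in bases P -> Int_active P a = (~: [set i])%SET ->
  a = greedy P i (a 0 i).
Proof.
move=> aB act; apply: flag_greedy => // k kn; rewrite truncation_tight //.
have [K [tK sK Ks]] := sandwiched_tight aB act kn.
have [iK|iK] := boolP (i \in K); apply/orP; [left|right].
  rewrite (_ : (i |: _)%SET = K) //; apply/eqP; rewrite eqEsubset Ks andbT.
  apply/subsetP => j; rewrite !inE; have [->//|ji] /= := eqVneq j i.
  by move=> jk; apply: (subsetP sK); rewrite !inE ji.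
rewrite (_ : ((i |: _) :\ i)%SET = K) //; apply/eqP; rewrite eqEsubset.
apply/andP; split.
  apply/subsetP => j; rewrite !inE => /andP[ji]; rewrite (negPf ji) /= => jk.
  by apply: (subsetP sK); rewrite !inE ji.
by rewrite subsetD1 Ks iK.
Qed.

(** The lower bound is strict because [initial n i.+1] is tight, whereas a
    tight [initial n i] would make [i] active. *)
Lemma cofacet_range (n : nat) (P : polymatroid n) (a : 'rV[int]_n)
    (i : 'I_n) :
  a \in bases P -> Int_active P a = (~: [set i])%SET ->
  P (initial n i.+1) - P (initial n i) < a 0 i <= P [set i]%SET.
Proof.
move=> aB act; rewrite -[a 0 i]weight1 weight_le // andbT weight1.
have ntp : ~~ tight P a (initial n i).
  have : i \notin Int_active P a by rewrite act !inE eqxx.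
  apply: contra => tp; apply/(Int_activeP _ aB); exists (initial n i).
  by rewrite inE ltnn.
have tS : tight P a (initial n i.+1).
  have [K [tK sK Ks]] := sandwiched_tight aB act (ltn_ord i).
  rewrite initial_late ?ltnSn // in Ks.
  have [iK|iK] := boolP (i \in K).
    rewrite (_ : initial n i.+1 = K) //; apply/eqP.
    rewrite eqEsubset Ks andbT -[initial n i.+1](@setD1K _ i) ?inE //.
    by rewrite subUset sub1set iK.
  case/negP: ntp; rewrite (_ : initial n i = K) //; apply/eqP.
  rewrite eqEsubset; apply/andP; split.
    apply: subset_trans sK; rewrite initialS setU1K //.
    by rewrite inE ltnn.
  apply/subsetP => j jK; have := subsetP Ks j jK.
  rewrite initialS !inE => /orP[/eqP ji|//].
  by rewrite -ji jK in iK.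
move: tS ntp; have := weight_le (initial n i) aB.
by rewrite /tight initialS weightU1 ?inE ?ltnn // -initialS; lia.
Qed.

Lemma count_cofacet (n : nat) (P : polymatroid n) (s : seq 'rV[int]_n)
    (i : 'I_n) :
  uniq s -> s =i bases P ->
  \sum_(a <- s) (Int_active P a == (~: [set i])%SET)%:R
    = P [set i]%SET - (P (initial n i.+1) - P (initial n i)).
Proof.
move=> us sP.
set lo : int := P (initial n i.+1) - P (initial n i).
(* The length of the interval is computed in [nat], so its bounds must be in
   order. *)
have lo_le : lo <= P [set i]%SET.
  have := rank_submodular P [set i]%SET (initial n i).
  rewrite -initialS (_ : (_ :&: _)%SET = set0) ?rank0 ?/lo; first by lia.
  by apply/setP => j; rewrite !inE; case: eqP => // ->; rewrite ltnn.
pose g (k : nat) := greedy P i (lo + k.+1%:Z).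
pose m := `|(P [set i]%SET - lo)%R|%N.
have gi k : g k 0 i = lo + k.+1%:Z by rewrite mxE eqxx.
transitivity ((size [seq a <- s | Int_active P a == (~: [set i])%SET])%:R : int).
  rewrite size_filter -sum1_count [in RHS]big_mkcond natr_sum.
  by apply: eq_bigr => a _; case: ifP.
have -> : size [seq a <- s | Int_active P a == (~: [set i])%SET]
          = size [seq g k | k <- iota 0 m].
  apply: perm_size; apply: uniq_perm; first exact: filter_uniq.
    rewrite map_inj_uniq ?iota_uniq // => k l gkl.
    by have : g k 0 i = g l 0 i; [rewrite gkl | rewrite !gi; lia].
  move=> /= a; rewrite mem_filter sP; apply/andP/mapP.
    case=> /eqP act aB; have := cofacet_range aB act; rewrite -/lo => ran.
    exists `|(a 0 i - lo - 1)%R|%N; first by rewrite mem_iota /m; lia.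
    rewrite [LHS](cofacet_greedy aB act); congr greedy; lia.
  case=> k; rewrite mem_iota => km ->.
  have ran : lo < lo + k.+1%:Z <= P [set i]%SET by rewrite /m in km; lia.
  by rewrite greedy_basis ?Int_greedy.
by rewrite size_map size_iota /m; lia.
Qed.

Lemma sum_initial (n : nat) (P : polymatroid n) :
  \sum_(i : 'I_n) (P (initial n i.+1) - P (initial n i))
    = P [set: 'I_n]%SET.
Proof.
rewrite -(big_mkord xpredT (fun k => P (initial n k.+1) - P (initial n k))).
by rewrite telescope_sumr // initial0 initial_full rank0 subr0.
Qed.

(** Cast to sums of indicators so that the counts over bases and over the
    inactive index can be exchanged. *)
Lemma card_cofacet (n : nat) (A : {set 'I_n}) :
  (0 < n)%N ->
  ((#|A| == n.-1)%:R : int) = \sum_i (A == (~: [set i])%SET)%:R.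
Proof.
move=> n0.
have -> : (#|A| == n.-1) = (#|(~: A)%SET| == 1%N).
  by have := cardsC A; rewrite card_ord; lia.
have eqC i : (A == (~: [set i])%SET) = ((~: A)%SET == [set i]%SET).
  by rewrite -(inj_eq (can_inj (@setCK _))) setCK.
under eq_bigr do rewrite eqC.
case: cards1P => [[i ->]|none].
  rewrite (bigD1 i) //= eqxx big1 ?addr0 // => j ji.
  by rewrite (inj_eq set1_inj) eq_sym (negPf ji).
rewrite big1 // => i _; case: eqP => // Ai; case: none; by exists i.
Qed.

Lemma count_Int_active (n : nat) (P : polymatroid n) (s : seq 'rV[int]_n) :
  (0 < n)%N -> uniq s -> s =i bases P ->
  \sum_(a <- s) (#|Int_active P a| == n.-1)%:R
    = \sum_i P [set i]%SET - P [set: 'I_n]%SET.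
Proof.
move=> n0 us sP; under eq_bigr do rewrite card_cofacet //.
rewrite exchange_big /=; under eq_bigr do rewrite (count_cofacet _ us sP).
by rewrite sumrB sum_initial.
Qed.

(** * Duality *)

Definition dual_rank (n : nat) (P : polymatroid n) (I : {set 'I_n}) : int :=
  P (~: I)%SET - P [set: 'I_n]%SET.

Lemma dual_rank0 (n : nat) (P : polymatroid n) :
  dual_rank P set0 = 0.
Proof. by rewrite /dual_rank setC0 subrr. Qed.

Lemma dual_rank_submodular (n : nat) (P : polymatroid n) (I J : {set 'I_n}) :
  dual_rank P (I :|: J) + dual_rank P (I :&: J)
    <= dual_rank P I + dual_rank P J.
Proof.
rewrite /dual_rank setCU setCI.
by have := rank_submodular P (~: I)%SET (~: J)%SET; lia.
Qed.

Definition dual (n : nat) (P : polymatroid n) : polymatroid n :=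
  Polymatroid (dual_rank0 P) (@dual_rank_submodular n P).

Lemma bases_dual (n : nat) (P : polymatroid n) (a : 'rV[int]_n) :
  (- a \in bases (dual P)) = (a \in bases P).
Proof.
have wN I : weight (- a) I = - weight a I.
  by rewrite /weight -sumrN; apply: eq_bigr => i _; rewrite mxE.
have wC I : weight a I + weight a (~: I)%SET = weight a [set: 'I_n]%SET.
  by rewrite -weightUI setUCr setICr weight0 addr0.
rewrite !in_bases /tight wN /= /dual_rank setCT rank0 sub0r eqr_opp.
case: eqP => [tT|]; rewrite ?andbF // !andbT.
apply/forallP/forallP => le I; have := le (~: I)%SET; have := wC I;
  by rewrite wN ?setCK; lia.
Qed.

Lemma Int_active_dual (n : nat) (P : polymatroid n) (a : 'rV[int]_n) :
  Int_active (dual P) (- a) = Ext_active P a.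
Proof.
apply/setP => i; rewrite !inE; apply: eq_forallb => j.
by rewrite -[in RHS]bases_dual !opprD opprK.
Qed.

Lemma count_Ext_active (n : nat) (P : polymatroid n) (s : seq 'rV[int]_n) :
  (0 < n)%N -> uniq s -> s =i bases P ->
  \sum_(a <- s) (#|Ext_active P a| == n.-1)%:R
    = \sum_(i : 'I_n) P ([set: 'I_n] :\ i)%SET
      - (n%:Z - 1) * P [set: 'I_n]%SET.
Proof.
move=> n0 us sP.
have us' : uniq [seq - a | a <- s] by rewrite map_inj_uniq //; exact: oppr_inj.
have sP' : [seq - a | a <- s] =i bases (dual P).
  by move=> a; rewrite -[a]opprK (mem_map oppr_inj) bases_dual sP.
have := count_Int_active n0 us' sP'; rewrite big_map.
under eq_bigr do rewrite Int_active_dual.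
move=> ->; rewrite /= /dual_rank setCT rank0 sumrB sumr_const card_ord.
have -> : \sum_(i : 'I_n) P (~: [set i])%SET
          = \sum_(i : 'I_n) P ([set: 'I_n] :\ i)%SET.
  by apply: eq_bigr => i _; rewrite -setTD.
by rewrite mulrBl mul1r sub0r -mulr_natl natz opprB opprK addrA addrAC.
Qed.

(** * The polynomial *)

Lemma subst_y1_tutte (n : nat) (P : polymatroid n) (s : seq 'rV[int]_n) :
  polymatroid_tutte P = \sum_(a <- s)
     ('X ^+ oi P a * 'Y ^+ oe P a * ('X + 'Y - 1) ^+ ie P a) ->
  subst_y1 (polymatroid_tutte P) = \sum_(a <- s) 'X ^+ #|Int_active P a|.
Proof.
move=> ->; rewrite /subst_y1 rmorph_sum /=; apply: eq_bigr => a _.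
rewrite !rmorphM !rmorphXn rmorphB rmorphD rmorph1 /= map_polyX map_polyC /=.
rewrite /horner_eval hornerX expr1n mulr1 addrK -exprD addnC.
by rewrite /ie /oi cardsID.
Qed.

Lemma subst_x1_tutte (n : nat) (P : polymatroid n) (s : seq 'rV[int]_n) :
  polymatroid_tutte P = \sum_(a <- s)
     ('X ^+ oi P a * 'Y ^+ oe P a * ('X + 'Y - 1) ^+ ie P a) ->
  subst_x1 (polymatroid_tutte P) = \sum_(a <- s) 'X ^+ #|Ext_active P a|.
Proof.
move=> ->; rewrite /subst_x1 horner_sum; apply: eq_bigr => a _.
rewrite !hornerE expr1n mul1r addrAC subrr add0r.
by rewrite -exprD addnC /ie /oe setIC cardsID.
Qed.

Theorem theorem15 (n : nat) (hn : (0 < n)%N) (P : polymatroid n) :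
  (subst_y1 (polymatroid_tutte P))`_n.-1
    = \sum_(i : 'I_n) rank P [set i]%SET - rank P [set: 'I_n]%SET
  /\
  (subst_x1 (polymatroid_tutte P))`_n.-1
    = \sum_(i : 'I_n) rank P ([set: 'I_n] :\ i)%SET
      - (n%:Z - 1) * rank P [set: 'I_n]%SET.
Proof.
pose s : seq 'rV[int]_n := fset_set [set` bases P]%classic.
have us : uniq s by exact: fset_uniq.
have sP : s =i bases P.
  move=> a; rewrite in_fset_set; last exact: bases_finite.
  by apply/idP/idP => [/set_mem|aB]; last exact: mem_set.
have sum_s : polymatroid_tutte P = \sum_(a <- s)
     ('X ^+ oi P a * 'Y ^+ oe P a * ('X + 'Y - 1) ^+ ie P a).
  by rewrite /polymatroid_tutte fsbig_finite //; exact: bases_finite.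
rewrite (subst_y1_tutte sum_s) (subst_x1_tutte sum_s) !coef_sum.
split.
  rewrite -(count_Int_active hn us sP); apply: eq_bigr => a _.
  by rewrite coefXn eq_sym.
rewrite -(count_Ext_active hn us sP); apply: eq_bigr => a _.
by rewrite coefXn eq_sym.
Qed.
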